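(* Let $(R,m)$ be a complete regular local ring of dimension $n$ in mixed characteristic $p$ with coefficient ring $V$, and let $B$ be its absolute integral closure. Let $p,x_1,\dots,x_{n-1}$ be a system of parameters of $R$ such that $x_1,\dots,x_{n-1}$ form a part of a regular system of parameters of $R$, and let $\underline{x}$ denote the ideal $(x_1,\dots,x_{n-1})$ of $R$. If $H_p^0\big(H_{\underline{x}}^{n-1}(\Omega_{B/V})\big)\neq 0$, then $H_m^{n-1}(\Omega_{B/V})\neq 0$.
   Context: $\Omega_{B/V}$ denotes the module of Kähler differentials; $H^i_{I}(-)$ is local cohomology with support in the ideal $I$, and $H^0_p(M)$ is the submodule of elements of $M$ killed by a power of $p$. Mixed characteristic $p$ means $R$ has characteristic $0$ and $R/m$ has characteristic $p>0$. The coefficient ring $V\subset R$ is a complete discrete valuation ring with maximal ideal $pV$ and residue field $R/m$. The absolute integral closure $B$ of $R$ is the integral closure of $R$ in an algebraic closure of its field of fractions. *)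

(* Defs.v *)
From HB Require Import structures.
From mathcomp Require Import all_boot all_order all_algebra.
From mathcomp Require Import all_classical.

Set Implicit Arguments.
Unset Strict Implicit.
Unset Printing Implicit Defensive.

Import Order.TTheory GRing.Theory Num.Theory.
Local Open Scope classical_set_scope.
Local Open Scope quotient_scope.
Local Open Scope ring_scope.

Definition is_ideal (R : comNzRingType) (I : set R) : Prop :=
  [/\ I 0, forall a b, I a -> I b -> I (a + b) & forall r a, I a -> I (r * a)].

Definition ideal_gen (R : comNzRingType) (A : set R) : set R :=
  [set r | forall J, is_ideal J -> A `<=` J -> J r].

(* The products of t elements of I do generate I^t; for t = 0 this is R. *)
Definition ideal_pow (R : comNzRingType) (I : set R) (t : nat) : set R :=
  ideal_gen [set r | exists2 f : 'I_t -> R, forall i, I (f i) & r = \prod_i f i].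

Definition radical (R : comNzRingType) (I : set R) : set R :=
  [set r | exists k : nat, I (r ^+ k)].

Definition is_prime_ideal (R : comNzRingType) (P : set R) : Prop :=
  [/\ is_ideal P, ~ P 1 & forall a b, P (a * b) -> P a \/ P b].

Definition is_maximal_ideal (R : comNzRingType) (M : set R) : Prop :=
  [/\ is_ideal M, ~ M 1 &
      forall J, is_ideal J -> ~ J 1 -> M `<=` J -> J = M].

Definition local_ring (R : comNzRingType) (m : set R) : Prop :=
  is_maximal_ideal m /\ forall M, is_maximal_ideal M -> M = m.

Definition noetherian (R : comNzRingType) : Prop :=
  forall I : set R, is_ideal I -> exists s : seq R, I = ideal_gen [set` s].

Definition prime_chain (R : comNzRingType) (l : nat) (P : nat -> set R) : Prop :=
  (forall i, (i <= l)%N -> is_prime_ideal (P i)) /\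
  (forall i, (i < l)%N -> P i `<` P i.+1).

Definition krull_dim (R : comNzRingType) (n : nat) : Prop :=
  (exists P : nat -> set R, prime_chain n P) /\
  (forall l (P : nat -> set R), prime_chain l P -> (l <= n)%N).

Definition regular_system (R : comNzRingType) (m : set R) (n : nat) (s : seq R) :=
  size s = n /\ ideal_gen [set` s] = m.

Definition regular_local_ring (R : comNzRingType) (m : set R) (n : nat) : Prop :=
  [/\ local_ring m, noetherian R, krull_dim R n &
      exists s : seq R, regular_system m n s].

Definition part_of_regular_system (R : comNzRingType) (m : set R) (n : nat)
    (s : seq R) : Prop :=
  exists t : seq R, regular_system m n (s ++ t).

(* For a Noetherian local ring of dimension n: n elements generating an
   m-primary ideal, i.e. an ideal whose radical is m. *)
Definition system_of_parameters (R : comNzRingType) (m : set R) (n : nat)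
    (s : seq R) : Prop :=
  size s = n /\ radical (ideal_gen [set` s]) = m.

(* R is the inverse limit of the rings R / I^t: separated, and every coherent
   sequence of residues comes from an element. *)
Definition adic_complete (R : comNzRingType) (I : set R) : Prop :=
  (forall r, (forall t, ideal_pow I t r) -> r = 0) /\
  (forall u : nat -> R, (forall t, ideal_pow I t (u t.+1 - u t)) ->
     exists l, forall t, ideal_pow I t (l - u t)).

(* The second and third conditions: R has characteristic 0 and p generates the
   kernel of Z -> R / m. *)
Definition mixed_char (R : comNzRingType) (m : set R) (p : nat) : Prop :=
  [/\ prime p, forall k : nat, (0 < k)%N -> k%:R != 0 :> R &
      forall k : nat, m k%:R <-> (p %| k)%N].

Definition is_dvr (V : idomainType) (mV : set V) : Prop :=
  [/\ local_ring mV, forall I : set V, is_ideal I -> exists a, I = ideal_gen [set a]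
    & mV <> [set 0]].

(* V is a subring of R through the injection f; the last condition says that
   V / pV -> R / m, which is well defined and injective by the previous one, is
   onto. *)
Definition coefficient_ring (R : comNzRingType) (m : set R) (p : nat)
    (V : idomainType) (f : {rmorphism V -> R}) : Prop :=
  let mV := ideal_gen [set (p%:R : V)] in
  [/\ injective f, is_dvr mV, adic_complete mV, f @^-1` m = mV &
      forall r, exists v, m (r - f v)].

Definition is_algebraic_closure (K : fieldType) (L : closedFieldType)
    (j : {rmorphism K -> L}) : Prop :=
  forall z, algebraicOver j z.

Section IntegralClosure.
Variables (A : comNzRingType) (K : fieldType) (f : {rmorphism A -> K}).

Definition int_closure_pred : {pred K} := fun z => `[< integralOver f z >].

Lemma int_closure_subring : subring_closed int_closure_pred.
Proof.
split=> [|x y|x y]; rewrite ?unfold_in; first exact/asboolP/integral1.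
- by move=> /asboolP xP /asboolP yP; apply/asboolP/integral_sub.
- by move=> /asboolP xP /asboolP yP; apply/asboolP/integral_mul.
Qed.

HB.instance Definition _ :=
  GRing.isSubringClosed.Build K int_closure_pred int_closure_subring.

Definition int_closure := {z : K | z \in int_closure_pred}.

HB.instance Definition _ := [isSub of int_closure for (@proj1_sig K _)].
HB.instance Definition _ := [Choice of int_closure by <:].
HB.instance Definition _ := [SubChoice_isSubComNzRing of int_closure by <:].

Lemma to_int_closure_subproof (a : A) : f a \in int_closure_pred.
Proof. by rewrite unfold_in; apply/asboolP/integral_id. Qed.

Definition to_int_closure (a : A) : int_closure :=
  exist _ (f a) (to_int_closure_subproof a).

Lemma to_int_closure_zmod : zmod_morphism to_int_closure.
Proof. by move=> x y; apply: val_inj; rewrite /= rmorphB. Qed.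

Lemma to_int_closure_monoid : monoid_morphism to_int_closure.
Proof. by split=> [|x y]; apply: val_inj; rewrite /= (rmorph1, rmorphM). Qed.

HB.instance Definition _ :=
  GRing.isZmodMorphism.Build A int_closure to_int_closure to_int_closure_zmod.
HB.instance Definition _ :=
  GRing.isMonoidMorphism.Build A int_closure to_int_closure to_int_closure_monoid.

End IntegralClosure.

Section AbsoluteIntegralClosure.
Variables (R : idomainType) (L : closedFieldType).
Variable j : {rmorphism {fraction R} -> L}.

Definition abs_int_closure := int_closure (j \o @tofrac R).

HB.instance Definition _ := GRing.ComNzRing.on abs_int_closure.

Definition to_aic : {rmorphism R -> abs_int_closure} :=
  @to_int_closure R L (j \o @tofrac R).

End AbsoluteIntegralClosure.

Definition is_derivation (A B : comNzRingType) (f : {rmorphism A -> B})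
    (M : lmodType B) (D : B -> M) : Prop :=
  [/\ forall b c, D (b + c) = D b + D c,
      forall b c, D (b * c) = b *: D c + c *: D b & forall a, D (f a) = 0].

(* The universal property, which determines (Omega, d) up to unique isomorphism. *)
Definition is_kaehler (A B : comNzRingType) (f : {rmorphism A -> B})
    (Omega : lmodType B) (d : B -> Omega) : Prop :=
  is_derivation f d /\
  forall (M : lmodType B) (D : B -> M), is_derivation f D ->
    exists2 phi : {linear Omega -> M}, forall b, D b = phi (d b) &
      forall psi : {linear Omega -> M}, (forall b, D b = psi (d b)) -> psi =1 phi.

Definition restrict_scalars (A B : comNzRingType) (f : {rmorphism A -> B})
  (M : lmodType B) : Type := M.

Section RestrictScalars.
Variables (A B : comNzRingType) (f : {rmorphism A -> B}) (M : lmodType B).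
Local Notation Mf := (restrict_scalars f M).

HB.instance Definition _ := GRing.Zmodule.on Mf.

Let scale (a : A) (x : Mf) : Mf := f a *: (x : M).
Let scaleA a b x : scale a (scale b x) = scale (a * b) x.
Proof. by rewrite /scale scalerA rmorphM. Qed.
Let scale1 : left_id 1 scale.
Proof. by move=> x; rewrite /scale rmorph1 scale1r. Qed.
Let scaleDr : right_distributive scale +%R.
Proof. by move=> a x y; exact: scalerDr. Qed.
Let scaleDl x : {morph scale^~ x : a b / a + b}.
Proof. by move=> a b; rewrite /scale rmorphD scalerDl. Qed.

HB.instance Definition _ :=
  GRing.Zmodule_isLmodule.Build A Mf scaleA scale1 scaleDr scaleDl.

End RestrictScalars.

Section QuotientModule.
Variables (R : comNzRingType) (M : lmodType R) (S : submodClosed M).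

(* S again: submodClosed, which also serves semimodules, carries no closure under
   opposite, and the library's quotient asks for it. *)
Definition quot_pred : {pred M} := S.

HB.instance Definition _ :=
  GRing.isZmodClosed.Build M quot_pred (GRing.submod_closedB (submodClosedP S)).

Definition quotm : Type := Quotient.quot quot_pred.

HB.instance Definition _ := GRing.Zmodule.on quotm.

Definition quotm_pi (x : M) : quotm := \pi_(Quotient.quot quot_pred) x.

Lemma quotm_eq x y : (quotm_pi x = quotm_pi y) <-> (x - y \in S).
Proof.
have -> : (x - y \in S) = (quotm_pi x == quotm_pi y) :=
  Quotient.idealrBE quot_pred x y.
by split=> [/eqP|/eqP].
Qed.

Lemma quotm_surj (q : quotm) : exists x, q = quotm_pi x.
Proof. by exists (repr (q : Quotient.quot quot_pred)); rewrite /quotm_pi reprK. Qed.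

Lemma quotm_piD x y : quotm_pi (x + y) = quotm_pi x + quotm_pi y.
Proof. exact: (raddfD (\pi_(Quotient.quot quot_pred))). Qed.

Let scale (a : R) (q : quotm) : quotm := quotm_pi (a *: repr (q : Quotient.quot quot_pred)).
Let scale_pi a x : scale a (quotm_pi x) = quotm_pi (a *: x).
Proof.
apply/quotm_eq; rewrite -scalerBr; apply: rpredZ.
by apply/quotm_eq; rewrite /quotm_pi reprK.
Qed.
Let scaleA a b x : scale a (scale b x) = scale (a * b) x.
Proof. by case: (quotm_surj x) => y ->; rewrite !scale_pi scalerA. Qed.
Let scale1 : left_id 1 scale.
Proof. by move=> x; case: (quotm_surj x) => y ->; rewrite scale_pi scale1r. Qed.
Let scaleDr : right_distributive scale +%R.
Proof.
move=> a x y; case: (quotm_surj x) (quotm_surj y) => x' -> [y' ->].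
by rewrite -quotm_piD !scale_pi scalerDr quotm_piD.
Qed.
Let scaleDl x : {morph scale^~ x : a b / a + b}.
Proof.
move=> a b; case: (quotm_surj x) => y ->.
by rewrite !scale_pi scalerDl quotm_piD.
Qed.

HB.instance Definition _ :=
  GRing.Zmodule_isLmodule.Build R quotm scaleA scale1 scaleDr scaleDl.

Lemma quotm_pi_is_linear : linear quotm_pi.
Proof. by move=> a x y; rewrite quotm_piD -scale_pi. Qed.

HB.instance Definition _ :=
  GRing.isLinear.Build R M quotm *:%R quotm_pi quotm_pi_is_linear.

End QuotientModule.

Section Image.
Variables (R : comNzRingType) (M N : lmodType R) (f : {linear M -> N}).

Definition im_pred : {pred N} := fun y => `[< exists x, y = f x >].

Lemma im_submod : submod_closed im_pred.
Proof.
split=> [|a x y]; rewrite ?unfold_in; first by apply/asboolP; exists 0; rewrite linear0.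
move=> /asboolP[x' ->] /asboolP[y' ->]; apply/asboolP.
by exists (a *: x' + y'); rewrite linearP.
Qed.

HB.instance Definition _ := GRing.isSubmodClosed.Build R N im_pred im_submod.

End Image.

Section Subquotient.
Variables (R : comNzRingType) (M : lmodType R) (Z S : submodClosed M).

Definition submodule : Type := {x : M | x \in Z}.

HB.instance Definition _ := [isSub of submodule for (@proj1_sig M _)].
HB.instance Definition _ := [Choice of submodule by <:].
HB.instance Definition _ := [SubChoice_isSubLmodule of submodule by <:].

Definition sub_pred : {pred submodule} := fun x => val x \in S.

Lemma sub_submod : submod_closed sub_pred.
Proof.
have memE (x : submodule) : (x \in sub_pred) = (val x \in S) by [].
split=> [|a x y]; rewrite !memE ?linear0 ?rpred0 // => xS yS.
by rewrite linearP rpredD ?rpredZ.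
Qed.

HB.instance Definition _ :=
  GRing.isSubmodClosed.Build R submodule sub_pred sub_submod.

(* Z / (Z :&: S) *)
Definition subquotient : lmodType R := quotm sub_pred.

End Subquotient.

Definition injective_module (R : comNzRingType) (E : lmodType R) : Prop :=
  forall (M N : lmodType R) (f : {linear M -> N}) (g : {linear M -> E}),
    injective f -> exists h : {linear N -> E}, forall x, h (f x) = g x.

Definition rat_int : {pred rat} := fun x => x \is a Num.int.

Lemma rat_int_zmod : zmod_closed rat_int.
Proof. by split=> [|x y xZ yZ]; [exact: rpred0 | exact: rpredB]. Qed.

HB.instance Definition _ := GRing.isZmodClosed.Build rat rat_int rat_int_zmod.

Definition QmodZ : zmodType := Quotient.quot rat_int.

Section Cofree.
Variables (R : comNzRingType) (J : Type).

Definition cofree_pred : {pred J -> R -> QmodZ} :=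
  fun F => `[< forall j, zmod_morphism (F j) >].

Lemma cofree_zmod : zmod_closed cofree_pred.
Proof.
split=> [|F G]; rewrite ?unfold_in.
  by apply/asboolP => j x y /=; rewrite subr0.
move=> /asboolP FP /asboolP GP; apply/asboolP => j x y.
rewrite [LHS]/(F j (x - y) - G j (x - y)) FP GP.
by rewrite [in RHS]/(F - G) !opprD !opprK addrACA.
Qed.

HB.instance Definition _ :=
  GRing.isZmodClosed.Build (J -> R -> QmodZ) cofree_pred cofree_zmod.

(* The product of J copies of the R-module Hom_Z(R, Q/Z). *)
Definition cofree : Type := {F : J -> R -> QmodZ | F \in cofree_pred}.

HB.instance Definition _ := [isSub of cofree for (@proj1_sig (J -> R -> QmodZ) _)].
HB.instance Definition _ := [Choice of cofree by <:].
HB.instance Definition _ := [SubChoice_isSubZmodule of cofree by <:].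


Lemma cofreeB (F : cofree) j : zmod_morphism (val F j).
Proof. by move/asboolP: (valP F). Qed.

Lemma cofreeD (F : cofree) j x y : val F j (x + y) = val F j x + val F j y.
Proof.
have FB := @cofreeB F j; have F0 : val F j 0 = 0.
  by have := FB 0 0; rewrite !subrr.
have FN z : val F j (- z) = - val F j z by have := FB 0 z; rewrite F0 !sub0r.
by rewrite -{1}[y]opprK FB FN opprK.
Qed.

Let act_subproof (a : R) (F : cofree) :
  (fun j s => val F j (s * a)) \in cofree_pred.
Proof. by apply/asboolP => j x y; rewrite mulrBl cofreeB. Qed.
Let act (a : R) (F : cofree) : cofree := Sub (fun j s => val F j (s * a)) (act_subproof a F).
Let actA a b F : act a (act b F) = act (a * b) F.
Proof. by apply: val_inj; apply/funext => j; apply/funext => s /=; rewrite mulrA. Qed.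
Let act1 : left_id 1 act.
Proof. by move=> F; apply: val_inj; apply/funext => j; apply/funext => s /=; rewrite mulr1. Qed.
Let actDr : right_distributive act +%R.
Proof. by move=> a F G; apply: val_inj. Qed.
Let actDl F : {morph act^~ F : a b / a + b}.
Proof.
move=> a b; apply: val_inj; apply/funext => j; apply/funext => s.
by rewrite /= mulrDr cofreeD.
Qed.

HB.instance Definition _ :=
  GRing.Zmodule_isLmodule.Build R cofree actA act1 actDr actDl.

End Cofree.

Section Embedding.
Variables (R : comNzRingType) (M : lmodType R).

Definition hull : lmodType R := cofree R {additive M -> QmodZ}.

Lemma embed_subproof (x : M) :
  (fun (chi : {additive M -> QmodZ}) (s : R) => chi (s *: x)) \in
    @cofree_pred R {additive M -> QmodZ}.
Proof. by apply/asboolP => chi s t; rewrite scalerBl raddfB. Qed.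

Definition embed (x : M) : hull :=
  exist (fun F => F \in @cofree_pred R {additive M -> QmodZ}) _ (embed_subproof x).

Lemma embed_is_linear : linear embed.
Proof.
move=> a x y; apply: val_inj; apply/funext => chi; apply/funext => s.
by rewrite /= scalerDr raddfD scalerA.
Qed.

HB.instance Definition _ :=
  GRing.isLinear.Build R M hull *:%R embed embed_is_linear.

End Embedding.

Section Resolution.
Variables (R : comNzRingType) (M : lmodType R).

(* 0 -> cosyzygy k -> hull (cosyzygy k) -> cosyzygy k.+1 -> 0 is exact. *)
Fixpoint cosyzygy (k : nat) : lmodType R :=
  if k is k'.+1 then quotm (im_pred (@embed R (cosyzygy k'))) else M.

Definition injres (k : nat) : lmodType R := hull (cosyzygy k).

Definition injres_d (k : nat) : {linear injres k -> injres k.+1} :=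
  @embed R (cosyzygy k.+1) \o @quotm_pi R _ (im_pred (@embed R (cosyzygy k))).

End Resolution.

Section PairZmodule.
Variables (U V : zmodType).
Implicit Types (x y : U) (q r : V).

Lemma pairB x y q r : (x, q) - (y, r) = (x - y, q - r). Proof. by []. Qed.

Lemma pairN x q : - (x, q) = (- x, - q). Proof. by []. Qed.

Lemma pairMn x q k : (x, q) *+ k = (x *+ k, q *+ k).
Proof. by elim: k => // k IH; rewrite !mulrSr IH. Qed.

Lemma pairMz x q (k : int) : (x, q) *~ k = (x *~ k, q *~ k).
Proof. by case: k => k; rewrite /intmul pairMn. Qed.

End PairZmodule.

Definition ratQZ : rat -> QmodZ := \pi_(Quotient.quot rat_int).

Lemma ratQZ_eq0 (r : rat) : (ratQZ r = 0) <-> (r \is a Num.int).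
Proof.
have -> : (r \is a Num.int) = (r - 0 \in rat_int) by rewrite subr0.
have -> : (r - 0 \in rat_int) = (ratQZ r == ratQZ 0) := Quotient.idealrBE _ _ _.
rewrite [ratQZ 0](raddf0 (\pi_(Quotient.quot rat_int))).
by split=> [/eqP|/eqP].
Qed.

Lemma ratQZMn (r : rat) k : ratQZ (r *+ k) = ratQZ r *+ k.
Proof. exact: (raddfMn (\pi_(Quotient.quot rat_int))). Qed.

Lemma QmodZ_divisible (q : QmodZ) k : (0 < k)%N -> exists c : QmodZ, c *+ k = q.
Proof.
move=> k0; exists (ratQZ (repr (q : Quotient.quot rat_int) / k%:R)).
rewrite -ratQZMn -[_ *+ k]mulr_natr divfK ?pnatr_eq0 -?lt0n //.
by rewrite /ratQZ reprK.
Qed.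

(* Q/Z is an injective abelian group, stated on graphs of partial maps. *)
Lemma character_extension (N : zmodType) (G0 : set (N * QmodZ)) :
  G0 0 -> (forall u v, G0 u -> G0 v -> G0 (u - v)) ->
  (forall q, G0 (0, q) -> q = 0) ->
  exists h : {additive N -> QmodZ}, forall u, G0 u -> h u.1 = u.2.
Proof.
move=> G00 G0B G0f.
pose P (G : set (N * QmodZ)) := [/\ forall u v, G u -> G v -> G (u - v),
  forall q, G (0, q) -> q = 0 & G !=set0 -> G0 `<=` G].
have [|A [[AB Af An] Amax]] := @Zorn_bigcup _ P.
  move=> F FP tot; split.
  - move=> u v [X FX Xu] [Y FY Yv].
    have [XY|YX] := tot X Y FX FY.
      by exists Y => //; have [YB _ _] := FP _ FY; apply: YB => //; apply: XY.
    by exists X => //; have [XB _ _] := FP _ FX; apply: XB => //; apply: YX.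
  - by move=> q [X FX Xq]; have [_ Xf _] := FP _ FX; apply: Xf.
  - move=> [u [X FX Xu]] w Gw; exists X => //.
    by have [_ _ Xn] := FP _ FX; apply: Xn => //; exists u.
have {}An : G0 `<=` A.
  suff /An : A !=set0 by [].
  apply: contrapT => nA.
  have A0 : A = set0 by apply/seteqP; split=> // u Au; case: nA; exists u.
  have PG0 : P G0 by split=> // _ u.
  by apply: (Amax G0) => //; rewrite A0; split=> [u []|/(_ 0 G00)].
have A0 := An _ G00.
have AN u : A u -> A (- u) by move=> Au; rewrite -sub0r; apply: AB.
have AD u v : A u -> A v -> A (u + v).
  by move=> Au Av; rewrite -[v]opprK; apply/AB/AN.
have AMn u k : A u -> A (u *+ k).
  by move=> Au; elim: k => [|k IH]; rewrite ?mulr0n // mulrSr; apply: AD.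
have Auniq x q q' : A (x, q) -> A (x, q') -> q = q'.
  move=> Aq Aq'; apply/subr0_eq/Af.
  by rewrite -(subrr x) -pairB; apply: AB.
have Atot x : exists q, A (x, q).
  apply: contrapT => xA.
  have [c cP] : exists c : QmodZ, forall k q, A (x *+ k, q) -> q = c *+ k.
    pose D k := (0 < k)%N && `[< exists q, A (x *+ k, q) >].
    have [exD|nD] := pselect (exists k, D k); last first.
      exists 0 => -[|k] q Aq; first by rewrite mulr0n; apply: Af.
      by case: nD; exists k.+1; apply/asboolP; exists q.
    case: (ex_minnP exD) => k0 /andP[k0_gt0 /asboolP[q0 Aq0]] k0min.
    have [c cE] := QmodZ_divisible q0 k0_gt0; exists c => k q Aq.
    have Ar : A (x *+ (k %% k0)%N, q - q0 *+ (k %/ k0)%N).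
      have := AB _ _ Aq (AMn _ (k %/ k0)%N Aq0).
      rewrite pairMn pairB -mulrnA {1}(divn_eq k k0) mulrnDr mulnC.
      by rewrite addrAC subrr add0r.
    have r0 : (k %% k0 = 0)%N.
      apply: contraTeq (ltn_pmod k k0_gt0) => r0; rewrite -leqNgt.
      by apply: k0min; rewrite /D lt0n r0; apply/asboolP; eexists; exact: Ar.
    rewrite r0 mulr0n in Ar; move/Af/subr0_eq: Ar => ->.
    by rewrite -cE -mulrnA mulnC [in RHS](divn_eq k k0) r0 addn0.
  pose B := [set u | exists2 v, A v & exists k : int, u = v + (x, c) *~ k].
  apply: (Amax B); split.
  - by move=> u Au; exists u => //; exists 0; rewrite mulr0z addr0.
  - move=> BA; apply: xA; exists c; apply: BA; exists 0 => //; exists 1.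
    by rewrite add0r.
  - move=> u v [u' Au [k ->]] [v' Av [l ->]]; exists (u' - v'); first exact: AB.
    by exists (k - l); rewrite mulrzBr opprD addrACA.
  - move=> q [[y r] Ayr [k]].
    rewrite pairMz => -[/esym/eqP]; rewrite addr_eq0 => /eqP yE ->.
    case: k yE => k yE.
      have := AN _ Ayr; rewrite pairN yE opprK => /cP rE.
      by rewrite -[r]opprK rE addNr.
    move: Ayr; rewrite yE NegzE mulrNz opprK => /cP ->.
    by rewrite mulrNz subrr.
  - by move=> _ u Gu; exists u; [exact: An|exists 0; rewrite mulr0z addr0].
have [h hP] := choice Atot.
have hB : zmod_morphism h.
  move=> y z; apply: (Auniq (y - z)) => //.
  exact: (AB (y, h y) (z, h z)).
pose hB' := GRing.isZmodMorphism.Build N QmodZ h hB.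
pose h' : {additive N -> QmodZ} := HB.pack h hB'.
by exists h' => -[y q] /An Ayq; apply: (Auniq y).
Qed.

Lemma enough_characters (N : zmodType) (x : N) :
  (forall h : {additive N -> QmodZ}, h x = 0) -> x = 0.
Proof.
move=> hx; apply: contrapT => /eqP x0.
have [c c0 cP] : exists2 c : QmodZ, c <> 0 & forall k, x *+ k = 0 -> c *+ k = 0.
  have [exD|nD] := pselect (exists k, (0 < k)%N && (x *+ k == 0)); last first.
    exists (ratQZ (2%:R^-1)); first by move/ratQZ_eq0.
    move=> [|k] // xk; case: nD; exists k.+1; exact/eqP.
  case: (ex_minnP exD) => k0 /andP[k0_gt0 /eqP xk0] k0min.
  have k0R : (k0%:R : rat) != 0 by rewrite pnatr_eq0 -lt0n.
  exists (ratQZ k0%:R^-1).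
    move/ratQZ_eq0 => /norm_intr_ge1; rewrite invr_eq0 k0R => /(_ isT).
    rewrite normfV normr_nat invf_ge1 ?ltr0n // lern1 leq_eqVlt ltnNge k0_gt0 orbF.
    by move=> /eqP k01; move: xk0; rewrite k01 mulr1n; apply/eqP.
  move=> k xk; rewrite -ratQZMn; apply/ratQZ_eq0.
  suff -> : (k = (k %/ k0) * k0)%N.
    by rewrite mulnC mulrnA -[_ *+ k0]mulr_natr mulVf // natr_int.
  rewrite {1}(divn_eq k k0) -[RHS]addn0; congr addn.
  apply: contraTeq (ltn_pmod k k0_gt0) => r0; rewrite -leqNgt; apply: k0min.
  rewrite lt0n r0 /=; move: xk; rewrite {1}(divn_eq k k0) mulrnDr mulnC mulrnA.
  by rewrite xk0 mul0rn add0r => ->.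
pose G0 : set (N * QmodZ) := [set u | exists k : int, u = (x *~ k, c *~ k)].
have [||q|h hP] := @character_extension N G0.
- by exists 0; rewrite !mulr0z.
- by move=> _ _ [k ->] [l ->]; exists (k - l); rewrite !mulrzBr.
- move=> -[[k|k] [xk ->]]; first exact: cP.
  rewrite NegzE mulrNz -pmulrn cP ?oppr0 //.
  by apply/eqP; rewrite -oppr_eq0 pmulrn -mulrNz -NegzE -xk.
have := hP (x, c); rewrite hx => /(_ _)/esym cE; apply: c0; apply: cE.
by exists 1.
Qed.

Section ResolutionTheory.
Variable R : comNzRingType.

Lemma embed_inj (M : lmodType R) : injective (@embed R M).
Proof.
apply: raddf_inj => x ex0; apply: enough_characters => h.
have /(congr1 (fun F => val F h 1)) := ex0.
by rewrite /= scale1r.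
Qed.

Lemma cofree_injective (J : Type) : injective_module (cofree R J).
Proof.
move=> M N f g f_inj.
have ext j : exists h : {additive N -> QmodZ}, forall x, h (f x) = val (g x) j 1.
  pose G0 : set (N * QmodZ) := [set u | exists x, u = (f x, val (g x) j 1)].
  have [||q|h hP] := @character_extension N G0.
  - by exists 0; rewrite !linear0.
  - move=> _ _ [x ->] [y ->]; exists (x - y).
    by rewrite pairB !linearB.
  - by move=> [x []] /esym; rewrite -(linear0 f) => /f_inj -> ->; rewrite linear0.
  by exists h => x; apply: (hP (f x, _)); exists x.
have [h hP] := choice ext.
have HP n : (fun j s => h j (s *: n)) \in @cofree_pred R J.
  by apply/asboolP => j s t; rewrite scalerBl raddfB.
pose H n : cofree R J := exist (fun F => F \in @cofree_pred R J) _ (HP n).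
have Hlin : linear H.
  move=> a x y; apply: val_inj; apply/funext => j; apply/funext => s.
  by rewrite /= scalerDr raddfD scalerA.
pose H' : {linear N -> cofree R J} :=
  HB.pack H (GRing.isLinear.Build R N (cofree R J) *:%R H Hlin).
exists H' => x; apply: val_inj; apply/funext => j; apply/funext => s.
by rewrite /= -linearZ hP linearZ /= mul1r.
Qed.

Variable M : lmodType R.

(* injres M is an injective resolution of M, augmented by embed: M -> injres M 0. *)
Lemma injres_injective k : injective_module (injres M k).
Proof. exact: cofree_injective. Qed.

Lemma injres_d_eq0 k (e : injres M k) :
  injres_d M k e = 0 <-> exists y : cosyzygy M k, e = embed y.
Proof.
rewrite -[X in _ = X](linear0 (@embed R (cosyzygy M k.+1))).
split=> [/embed_inj|[y ->]].
  rewrite -(linear0 (@quotm_pi R _ _)) => /quotm_eq; rewrite subr0.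
  by move=> /asboolP.
congr embed; rewrite -(linear0 (@quotm_pi R _ _)); apply/quotm_eq.
by rewrite subr0; apply/asboolP; exists y.
Qed.

Lemma injres_exact0 (e : injres M 0) :
  injres_d M 0 e = 0 <-> exists x : M, e = embed x.
Proof. exact: injres_d_eq0. Qed.

Lemma injres_exact k (e : injres M k.+1) :
  injres_d M k.+1 e = 0 <-> exists e', e = injres_d M k e'.
Proof.
split=> [/injres_d_eq0[y ->]|[e' ->]]; last first.
  by apply/injres_d_eq0; eexists.
by have [e' ->] := quotm_surj y; exists e'.
Qed.

End ResolutionTheory.

Lemma ideal_pow_ideal (R : comNzRingType) (I : set R) t : is_ideal (ideal_pow I t).
Proof.
split=> [J [] //|a b aI bI J JI sJ|r a aI J JI sJ].
- by case: (JI) => _ JD _; apply: JD; [apply: aI | apply: bI].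
- by case: (JI) => _ _ JM; apply: JM; apply: aI.
Qed.

Lemma ideal_pow_sub (R : comNzRingType) (I : set R) s t :
  (s <= t)%N -> ideal_pow I t `<=` ideal_pow I s.
Proof.
move=> /subnKC <- a; apply; first exact: ideal_pow_ideal.
move=> _ [f fI ->]; rewrite big_split_ord /= mulrC.
case: (ideal_pow_ideal I s) => _ _; apply; move=> J _; apply.
by exists (fun i => f (lshift _ i)).
Qed.

Section LocalCohomology.
Variables (R : comNzRingType) (I : set R).

(* Gamma_I(M) *)
Definition torsion_pred (M : lmodType R) : {pred M} :=
  fun x => `[< exists t, forall a, ideal_pow I t a -> a *: x = 0 >].

Lemma torsion_submod (M : lmodType R) : submod_closed (@torsion_pred M).
Proof.
split=> [|a x y]; first by apply/asboolP; exists 0%N => a _; rewrite scaler0.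
move=> /asboolP[s sx] /asboolP[t ty]; apply/asboolP; exists (maxn s t) => b bI.
rewrite scalerDr scalerA mulrC -scalerA sx ?ty ?scaler0 ?addr0 //.
- exact: ideal_pow_sub (leq_maxr s t) _ bI.
- exact: ideal_pow_sub (leq_maxl s t) _ bI.
Qed.

HB.instance Definition _ M :=
  GRing.isSubmodClosed.Build R M (@torsion_pred M) (@torsion_submod M).

Variable M : lmodType R.

Definition cocycle_pred (i : nat) : {pred injres M i} :=
  fun e => (e \in @torsion_pred (injres M i)) && (injres_d M i e == 0).

Definition coboundary_pred (i : nat) : {pred injres M i} :=
  match i with
  | 0 => fun e => e == 0
  | k.+1 => fun e =>
      `[< exists2 e', e' \in @torsion_pred (injres M k) & e = injres_d M k e' >]
  end.

Lemma cocycle_submod i : submod_closed (@cocycle_pred i).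
Proof.
split=> [|a x y]; first by rewrite unfold_in rpred0 linear0 eqxx.
move=> /andP[xT /eqP x0] /andP[yT /eqP y0]; apply/andP; split.
  by rewrite rpredD ?rpredZ.
by rewrite linearP x0 y0 scaler0 addr0.
Qed.

HB.instance Definition _ i :=
  GRing.isSubmodClosed.Build R (injres M i) (@cocycle_pred i) (cocycle_submod i).

Lemma coboundary_submod i : submod_closed (@coboundary_pred i).
Proof.
case: i => [|k]; split=> [|a x y].
- by rewrite unfold_in /= eqxx.
- by move=> /eqP-> /eqP->; rewrite unfold_in scaler0 addr0 eqxx.
- by apply/asboolP; exists 0; rewrite ?rpred0 ?linear0.
- move=> /asboolP[x' xT ->] /asboolP[y' yT ->]; apply/asboolP.
  by exists (a *: x' + y'); rewrite ?linearP ?rpredD ?rpredZ.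
Qed.

HB.instance Definition _ i :=
  GRing.isSubmodClosed.Build R (injres M i) (@coboundary_pred i) (coboundary_submod i).

(* H^i_I(M): the i-th cohomology of the complex Gamma_I(injres M), that is, the
   right derived functor of Gamma_I at M. *)
Definition local_cohomology (i : nat) : lmodType R :=
  subquotient (@cocycle_pred i) (@coboundary_pred i).

End LocalCohomology.

(* H^0_p(H) *)
Definition p_torsion (R : comNzRingType) (p : nat) (H : lmodType R) : set H :=
  [set h | exists k : nat, (p%:R ^+ k : R) *: h = 0].

(* Main.v *)
Require Import Defs.
From HB Require Import structures.
From mathcomp Require Import all_boot all_order all_algebra.
From mathcomp Require Import all_classical.

Set Implicit Arguments.
Unset Strict Implicit.
Unset Printing Implicit Defensive.

Import Order.TTheory GRing.Theory Num.Theory.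
Local Open Scope classical_set_scope.
Local Open Scope ring_scope.

(** For a Noetherian ring R, an R-module M, an ideal I, an element y and
    m = rad (I + (y)), the sequence
    H^i_m(M) -> H^i_I(M) -> H^i_I(M)[1/y] is exact, so the part of H^i_I(M) killed
    by powers of y is the image of H^i_m(M); if it is nonzero, so is H^i_m(M).
    The theorem is the case y = p, I = (x_1, ..., x_(n-1)), i = n - 1.

    The exactness is checked on cocycles of an injective resolution E. Let e be
    a cocycle of Gamma_I(E^i) with y^k e = d e' and e' in Gamma_I(E^(i-1)). If
    some f in Gamma_I(E^(i-1)) satisfies y^(N+k) f = y^N e', then e - d f is
    cohomologous to e in Gamma_I(E) and is killed by y^(N+k), hence lies in
    Gamma_m(E^i). When the class of e is nonzero, e - d f is not a coboundary of
    Gamma_m(E), because Gamma_m is contained in Gamma_I. Such an f exists by injectivity of E^(i-1)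
    ([torsion_divisible]); that an element of Gamma_I killed by a power of y lies
    in Gamma_m is [torsion_pred_radical]. *)

(** * Ideals, radicals and saturations *)

Section Ideals.
Variable R : comNzRingType.
Implicit Types (A B I J : set R) (a b c r y : R).

Lemma ideal_gen_ideal A : is_ideal (ideal_gen A).
Proof.
split=> [J [] //|a b aA bA J JI AJ|r a aA J JI AJ].
- by case: (JI) => _ JD _; apply: JD; [exact: aA|exact: bA].
- by case: (JI) => _ _ JM; apply: JM; exact: aA.
Qed.

Lemma sub_ideal_gen A : A `<=` ideal_gen A.
Proof. by move=> a Aa J _; apply. Qed.

Lemma ideal_pow_mono I J t : I `<=` J -> ideal_pow I t `<=` ideal_pow J t.
Proof.
move=> IJ r rI; apply: rI; first exact: ideal_pow_ideal.
move=> _ [f fI ->]; apply: sub_ideal_gen.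
by exists f => // i; exact: IJ.
Qed.

Lemma ideal_pow_exp I t a : I a -> ideal_pow I t (a ^+ t).
Proof.
move=> Ia; apply: sub_ideal_gen; exists (fun=> a) => //.
by rewrite prodr_const card_ord.
Qed.

Lemma radical_ideal I : is_ideal I -> is_ideal (radical I).
Proof.
case=> I0 ID IM; split.
- by exists 1%N; rewrite expr1.
- move=> a b [k ak] [l bl]; exists (k + l)%N; rewrite exprDn.
  apply: big_ind => // i _; rewrite -mulr_natl; apply: (IM).
  have [il|/ltnW li] := leqP l i.
    by rewrite -(subnK il) exprD mulrA; exact: IM.
  by rewrite -addnBA // [X in a ^+ X]addnC exprD mulrAC; exact: IM.
- by move=> r a [k ak]; exists k; rewrite exprMn; exact: IM.
Qed.

(** When a product of k + t factors a * y + b is expanded, each monomial has at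
    least k factors y or at least t factors b; peeling off one
    factor at a time trades c for c * y or c * b, which avoids writing the expansion. *)
Lemma prod_adjoin A I y k t c (s : seq R) :
  is_ideal A -> A (y ^+ k * c) ->
  (forall q : seq R, size q = t -> (forall b, b \in q -> I b) ->
     A (\prod_(b <- q) b * c)) ->
  size s = (k + t)%N ->
  (forall z, z \in s -> exists a b, I b /\ z = a * y + b) ->
  A (\prod_(z <- s) z * c).
Proof.
move=> AI; have [_ AD AM] := AI.
elim: s k t c => [|z s IHs] k t c yc qc.
  move=> /esym/eqP; rewrite addn_eq0 => /andP[_ /eqP t0] _.
  have := qc [::]; rewrite !big_nil; exact.
case: k t yc qc => [|k] [|t] yc qc; try by move=> _ _; apply: AM; rewrite -[c]mul1r.
  by move=> _ _; apply: AM; have := qc [::]; rewrite big_nil mul1r; apply.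
rewrite addSn => -[sz] sI.
have [a [b [Ib zE]]] := sI z (mem_head _ _).
have sI' z' : z' \in s -> exists a b, I b /\ z' = a * y + b.
  by move=> z's; apply: sI; rewrite inE z's orbT.
rewrite big_cons zE mulrDl mulrDl; apply: AD.
  rewrite -2!mulrA; apply: (AM a); rewrite mulrCA.
  apply: (IHs k t.+1) => //; first by rewrite mulrA -exprSr.
  by move=> q qt qI; rewrite mulrCA; apply/AM/qc.
rewrite -mulrA mulrCA; apply: (IHs k.+1 t) => //.
- by rewrite mulrCA; exact: AM.
- move=> q qt qI; have := qc (b :: q); rewrite big_cons -mulrA mulrCA /= qt.
  apply=> //.
  by move=> b'; rewrite inE => /predU1P[->//|/qI].
- by rewrite sz addSnnS.
Qed.

Lemma ideal_gen_cons y (s : seq R) r : ideal_gen [set` y :: s] r ->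
  exists a b, ideal_gen [set` s] b /\ r = a * y + b.
Proof.
have [G0 GD GM] := ideal_gen_ideal [set` s].
pose J := [set r | exists a b, ideal_gen [set` s] b /\ r = a * y + b].
move=> /(_ J); apply.
  split.
  - by exists 0, 0; rewrite mul0r addr0.
  - move=> _ _ [a [b [bs ->]]] [a' [b' [bs' ->]]].
    by exists (a + a'), (b + b'); split; [exact: GD|rewrite mulrDl addrACA].
  - move=> u _ [a [b [bs ->]]].
    by exists (u * a), (u * b); split; [exact: GM|rewrite mulrDr mulrA].
move=> z /=; rewrite inE => /predU1P[->|zs].
  by exists 1, 0; rewrite mul1r addr0.
by exists 0, z; rewrite mul0r add0r; split=> //; exact: sub_ideal_gen.
Qed.

(** Induction on the generators, one being adjoined at a time by
    [prod_adjoin]. *)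
Lemma fg_pow_sub_radical A (s : seq R) : is_ideal A ->
  [set` s] `<=` radical A -> exists t, ideal_pow (ideal_gen [set` s]) t `<=` A.
Proof.
move=> AI sA; have [A0 AD AM] := AI.
suff [t tP] : exists t, forall q : seq R, size q = t ->
    (forall b, b \in q -> ideal_gen [set` s] b) -> A (\prod_(b <- q) b).
  exists t => r rP; apply: rP => // _ [f fI ->].
  rewrite -(big_map f predT id); apply: tP; first
    by rewrite size_map /index_enum unlock -enumT size_enum_ord.
  by move=> b /mapP[i _ ->].
elim: s sA => [|y s IHs] sA.
  exists 1%N => -[|b []] //= _ bP; rewrite big_seq1.
  by apply: (bP b (mem_head _ _)) => // z.
have [k yk] := sA y (mem_head _ _).
have [|t tP] := IHs; first by move=> z zs; apply: sA; rewrite /= inE zs orbT.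
exists (k + t)%N => q qt qI; rewrite -[X in A X]mulr1.
apply: (@prod_adjoin A (ideal_gen [set` s]) y k t) => //.
- by rewrite mulr1.
- by move=> q' q't q'I; rewrite mulr1; exact: tP.
- by move=> z /qI /ideal_gen_cons.
Qed.

(** The saturation of J with respect to y is finitely generated, so that one
    power of y serves for all of its elements. *)
Lemma noetherian_saturation J y : noetherian R -> is_ideal J ->
  exists N, forall k r, J (y ^+ k * r) -> J (y ^+ N * r).
Proof.
move=> Rn [J0 JD JM].
have JX k l r : (k <= l)%N -> J (y ^+ k * r) -> J (y ^+ l * r).
  by move=> kl Jr; rewrite -(subnK kl) exprD -mulrA; exact: JM.
have [|s sE] := Rn [set r | exists k, J (y ^+ k * r)].
  split=> [|a b [k ak] [l bl]|r a [k ak]].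
  - by exists 0%N; rewrite mulr0.
  - exists (maxn k l); rewrite mulrDr; apply: JD.
      exact: JX (leq_maxl _ _) ak.
    exact: JX (leq_maxr _ _) bl.
  - by exists k; rewrite mulrCA; exact: JM.
have [N NP] : exists N, forall z, z \in s -> J (y ^+ N * z).
  have : [set` s] `<=` [set r | exists k, J (y ^+ k * r)].
    by rewrite sE; exact: sub_ideal_gen.
  elim: s {sE} => [|z s IHs] sP; first by exists 0%N.
  have [k kz] := sP z (mem_head _ _).
  have [|N NP] := IHs; first by move=> w ws; apply: sP; rewrite /= inE ws orbT.
  exists (maxn k N) => w; rewrite inE => /predU1P[->|/NP].
    exact: JX (leq_maxl _ _) kz.
  exact: JX (leq_maxr _ _).
exists N => k r kr.
have : ideal_gen [set` s] r by rewrite -sE; exists k.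
move=> /(_ [set r | J (y ^+ N * r)]); apply=> //; split=> [|a b aN bN|u a aN] /=.
- by rewrite mulr0.
- by rewrite mulrDr; exact: JD.
- by rewrite mulrCA; exact: JM.
Qed.

End Ideals.

(** * Extending maps from ideals *)

Section Baer.
Variables (R : comNzRingType) (I : set R).
Hypothesis I_ideal : is_ideal I.

Definition ideal_pred : {pred R^o} := fun r => `[< I r >].

Lemma ideal_pred_submod : submod_closed ideal_pred.
Proof.
have [I0 ID IM] := I_ideal; split=> [|a r s]; first exact/asboolP.
by move=> /asboolP Ir /asboolP Is; apply/asboolP/ID => //; exact: IM.
Qed.

(** Half of Baer's criterion. The map on I is given by its graph G, so that it
    may be described through representatives, functionality of G being its
    well-definedness. *)
Lemma injective_extend_ideal (E : lmodType R) (G : R -> E -> Prop) :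
  injective_module E ->
  (forall r, I r -> exists e, G r e) ->
  (forall r e e', G r e -> G r e' -> e = e') ->
  (forall a r s e e', G r e -> G s e' -> G (a * r + s) (a *: e + e')) ->
  exists f : E, forall r e, I r -> G r e -> r *: f = e.
Proof.
move=> E_inj Gtot Gfun Glin.
pose S : submodClosed R^o := HB.pack ideal_pred
  (GRing.isSubmodClosed.Build R R^o ideal_pred ideal_pred_submod).
have SI (u : submodule S) : I (val u) by apply/asboolP; exact: (valP u).
have [g gP] := choice (fun u : submodule S => Gtot _ (SI u)).
have glin : linear g.
  move=> a u v; apply: (Gfun (val (a *: u + v))) => //.
  exact: (Glin a (val u) (val v) _ _ (gP u) (gP v)).
pose g' : {linear submodule S -> E} :=
  HB.pack g (GRing.isLinear.Build R (submodule S) E *:%R g glin).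
pose incl : {linear submodule S -> R^o} := val.
have [h hP] := E_inj _ _ incl g' val_inj.
exists (h (1 : R^o)) => r e Ir Gre.
have rS : (r : R^o) \in S by apply/asboolP.
have := hP (exist _ (r : R^o) rS); rewrite /= => hr.
apply: (Gfun r) Gre; rewrite -linearZ /= .
have -> : r *: (1 : R^o) = r by exact: mulr1.
by rewrite hr; exact: (gP (exist _ (r : R^o) rS)).
Qed.

End Baer.

(** * The torsion functor on modules *)

Section Torsion.
Variable R : comNzRingType.
Implicit Types (I J : set R) (E M : lmodType R).

Lemma torsion_pred_mono I J E : I `<=` J ->
  {subset @torsion_pred R J E <= @torsion_pred R I E}.
Proof.
move=> IJ e /asboolP[t te]; apply/asboolP; exists t => a aI.
by apply: te; exact: ideal_pow_mono aI.
Qed.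

Lemma torsion_pred_linear I E M (g : {linear E -> M}) (e : E) :
  e \in @torsion_pred R I E -> g e \in @torsion_pred R I M.
Proof.
move=> /asboolP[t te]; apply/asboolP; exists t => a aI.
by rewrite -linearZ te ?linear0.
Qed.

(** Surjectivity of Gamma_I(E) -> Gamma_I(E)[1/y], without denominators. With J
    a power of I killing e and (J : y^N) the y-saturation of J, the rule
    a + y^(N + k) * b |-> (y^N * b) *: e is well defined on the ideal
    J + (y^(N + k)): if y^(N + k) * b is in J, so is y^N * b. The value f at 1 of
    an extension to R is killed by J, because the map vanishes on J. *)
Lemma torsion_divisible I E (y : R) k (e : E) :
  noetherian R -> injective_module E -> e \in @torsion_pred R I E ->
  exists2 f, f \in @torsion_pred R I E &
    exists N, y ^+ (N + k) *: f = y ^+ N *: e.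
Proof.
move=> Rn E_inj /asboolP[t te].
have JI := ideal_pow_ideal I t; have [J0 JD JM] := JI.
have JB a b : ideal_pow I t a -> ideal_pow I t b -> ideal_pow I t (a - b).
  by move=> Ja Jb; apply: JD => //; rewrite -mulN1r; exact: JM.
have [N NP] := noetherian_saturation y Rn JI.
pose K := [set r | exists a b, ideal_pow I t a /\ r = a + y ^+ (N + k) * b].
pose G r (u : E) := exists a b,
  [/\ ideal_pow I t a, r = a + y ^+ (N + k) * b & u = (y ^+ N * b) *: e].
have Glin a r s u v : G r u -> G s v -> G (a * r + s) (a *: u + v).
  move=> [c [b [Jc -> ->]]] [c' [b' [Jc' -> ->]]].
  exists (a * c + c'), (a * b + b'); split; first by apply: JD => //; exact: JM.
    by rewrite !mulrDr addrACA !mulrA [a * y ^+ _]mulrC.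
  by rewrite scalerA -scalerDl mulrDr mulrCA.
have KI : is_ideal K.
  split=> [|_ _ [a [b [Ja ->]]] [a' [b' [Ja' ->]]]|r _ [a [b [Ja ->]]]].
  - by exists 0, 0; rewrite mulr0 addr0.
  - exists (a + a'), (b + b'); split; first exact: JD.
    by rewrite mulrDr addrACA.
  - exists (r * a), (r * b); split; first exact: JM.
    by rewrite mulrDr mulrCA.
have KG r : K r -> exists u, G r u.
  by move=> [a [b [Ja ->]]]; exists ((y ^+ N * b) *: e), a, b.
have Gfun r u v : G r u -> G r v -> u = v.
  move=> [a [b [Ja rE ->]]] [a' [b' [Ja' rE' ->]]]; apply/subr0_eq.
  rewrite -scalerBl -mulrBr; apply: te; apply: (NP (N + k)%N).
  have -> : y ^+ (N + k) * (b - b') = a' - a; last exact: JB.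
  apply/eqP; rewrite mulrBr subr_eq addrAC -rE' rE addrAC subrr add0r.
  exact: eqxx.
have [f fP] := injective_extend_ideal KI E_inj KG Gfun Glin.
exists f.
  apply/asboolP; exists t => a Ja; apply: fP.
    by exists a, 0; rewrite mulr0 addr0.
  by exists a, 0; rewrite !mulr0 addr0 scale0r.
exists N; apply: fP.
  by exists 0, 1; rewrite mulr1 add0r.
by exists 0, 1; rewrite !mulr1 add0r.
Qed.

(** The annihilator of e contains a power of y and a power of the ideal (s), so
    its radical contains the finitely generated ideal m, and it contains a power
    of m. *)
Lemma torsion_pred_radical (s : seq R) (m : set R) E (y : R) N (e : E) :
  noetherian R -> is_ideal m ->
  m `<=` radical (ideal_gen [set` y :: s]) ->
  e \in @torsion_pred R (ideal_gen [set` s]) E -> y ^+ N *: e = 0 ->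
  e \in @torsion_pred R m E.
Proof.
move=> Rn mI mrad /asboolP[t te] ye.
pose A := [set a | a *: e = 0].
have AI : is_ideal A.
  split=> [|a b Aa Ab|r a Aa]; rewrite /A /=.
  - by rewrite scale0r.
  - by rewrite scalerDl Aa Ab addr0.
  - by rewrite -scalerA Aa scaler0.
have [u mE] := Rn m mI.
have uA : [set` u] `<=` radical A.
  move=> z uz; have [|k zk] := mrad z; first by rewrite mE; exact: sub_ideal_gen.
  have [|l zkl] := zk _ (radical_ideal AI); last by exists (k * l)%N; rewrite exprM.
  move=> w /=; rewrite inE => /predU1P[->|ws]; first by exists N.
  by exists t; apply: te; apply: ideal_pow_exp; exact: sub_ideal_gen.
have [q qA] := fg_pow_sub_radical AI uA.
by apply/asboolP; exists q => a; rewrite mE => /qA.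
Qed.

(** * Local cohomology classes *)

Section Classes.
Variables (I : set R) (M : lmodType R) (i : nat).

Lemma local_cohomology_class (h : local_cohomology I M i) :
  exists2 e : injres M i, e \in @cocycle_pred R I M i &
    forall a : R, (a *: h == 0) = (a *: e \in @coboundary_pred R I M i).
Proof.
have [z ->] := quotm_surj h; exists (val z) => [|a]; first exact: valP.
rewrite -linearZ -(linear0 (@quotm_pi R _ _)) /=.
by apply/eqP/idP => [/quotm_eq|zB]; last apply/quotm_eq; rewrite subr0.
Qed.

Lemma local_cohomology_neq0 (e : injres M i) :
  e \in @cocycle_pred R I M i -> e \notin @coboundary_pred R I M i ->
  exists h : local_cohomology I M i, h != 0.
Proof.
move=> eZ eB; pose z : submodule (@cocycle_pred R I M i) := Sub e eZ.
exists (quotm_pi (sub_pred (@coboundary_pred R I M i)) z).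
apply: contra eB => /eqP; rewrite -(linear0 (@quotm_pi R _ _)) => /quotm_eq.
by rewrite subr0.
Qed.

End Classes.
End Torsion.

(** A cocycle representing h is changed by a coboundary of Gamma_I until a power
    of y kills it; it then represents a class of H^i_m(M), which is nonzero since
    coboundaries of Gamma_m are coboundaries of Gamma_I. *)
Lemma local_cohomology_power_torsion (R : comNzRingType) (s : seq R) (y : R)
    (m : set R) (M : lmodType R) (i k : nat)
    (h : local_cohomology (ideal_gen [set` s]) M i) :
  noetherian R -> m = radical (ideal_gen [set` y :: s]) ->
  y ^+ k *: h = 0 -> h != 0 ->
  exists h' : local_cohomology m M i, h' != 0.
Proof.
move=> Rn mE; set I := ideal_gen _ in h *.
have mI : is_ideal m by rewrite mE; exact/radical_ideal/ideal_gen_ideal.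
have Im : I `<=` m.
  move=> r Ir; rewrite mE; exists 1%N; rewrite expr1; apply: Ir.
    exact: ideal_gen_ideal.
  by move=> z zs; apply: sub_ideal_gen; rewrite /= inE zs orbT.
have toM N (e : injres M i) : e \in @torsion_pred R I _ -> y ^+ N *: e = 0 ->
    e \in @torsion_pred R m _.
  by move=> eI ye; apply: (@torsion_pred_radical R s) ye; rewrite // mE.
have [e /andP[eT /eqP de] hE] := local_cohomology_class h.
move=> /eqP; rewrite hE => ykB; rewrite -[h]scale1r hE scale1r => eB.
(* In degree 0 there are no coboundaries, and y ^+ k already kills e. *)
case: i => [|i] in h toM e eT de hE ykB eB *.
  apply: (@local_cohomology_neq0 R m M 0 e) => //.
  by apply/andP; split; [exact: (toM k e eT (eqP ykB))|exact/eqP].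
have /asboolP[e' e'T ye] := ykB.
have [f fT [N fE]] := torsion_divisible y k Rn (@injres_injective R M i) e'T.
have dd : injres_d M i.+1 (injres_d M i f) = 0.
  by apply/injres_exact; exists f.
apply: (@local_cohomology_neq0 R m M i.+1 (e - injres_d M i f)).
  apply/andP; split; last by apply/eqP; rewrite linearB de dd subrr.
  apply: (toM (N + k)%N).
    by rewrite -scaleN1r rpredD ?rpredZ //; exact: torsion_pred_linear fT.
  rewrite scalerBr -linearZ_LR fE linearZ_LR exprD -scalerA ye.
  exact: subrr.
apply: contra eB => /asboolP[g gT gE]; apply/asboolP.
exists (f + g); last by rewrite linearD -gE addrC subrK.
by rewrite rpredD //; exact: torsion_pred_mono gT.
Qed.

Theorem mainTheorem10 (n p : nat)
    (R : idomainType) (m : set R)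
    (V : idomainType) (iV : {rmorphism V -> R})
    (L : closedFieldType) (j : {rmorphism {fraction R} -> L})
    (x : (n.-1).-tuple R)
    (Omega : lmodType (abs_int_closure j)) (d : abs_int_closure j -> Omega)
    (R_regular : regular_local_ring m n)
    (R_complete : adic_complete m)
    (R_mixed : mixed_char m p)
    (V_coef : coefficient_ring m p iV)
    (L_closure : is_algebraic_closure j)
    (px_sop : system_of_parameters m n (p%:R :: x))
    (x_regular : part_of_regular_system m n x)
    (Omega_kaehler : is_kaehler (to_aic j \o iV) d) :
  let M : lmodType R := restrict_scalars (to_aic j) Omega in
  (exists2 h : local_cohomology (ideal_gen [set` x]) M n.-1,
     p_torsion p h & h != 0) ->
  exists h : local_cohomology m M n.-1, h != 0.
Proof.
move=> M [h [k pkh] h0].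
have [_ Rn _ _] := R_regular; have [_ mE] := px_sop.
exact: (local_cohomology_power_torsion Rn (esym mE) pkh h0).
Qed.
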